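(* The set $\mathbb{R}$ (of all minimal rational Cauchy filters) is uncountable.
   Context: For $q\in\mathbb{Q}$ and rational $\varepsilon>0$ let $q_\varepsilon=\{x\in\mathbb{Q}\mid q-\varepsilon<x<q+\varepsilon\}$. A (rational) filter is a non-empty collection $\mathcal{F}$ of subsets of $\mathbb{Q}$ closed under binary intersections and under supersets (in $\mathbb{Q}$); the improper filter $\mathcal{P}(\mathbb{Q})$ is allowed as a filter. A filter $\mathcal{F}$ is Cauchy if for every rational $\varepsilon>0$ there is $q\in\mathbb{Q}$ with $q_\varepsilon\in\mathcal{F}$. A minimal Cauchy filter is a Cauchy filter $\mathcal{F}$ such that any Cauchy filter $\mathcal{G}\subseteq\mathcal{F}$ satisfies $\mathcal{G}=\mathcal{F}$. In this statement $\mathbb{R}$ denotes the set of all minimal Cauchy filters in $\mathbb{Q}$. *)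

(* Defs.v *)
From mathcomp Require Import all_boot all_order all_algebra.
From mathcomp Require Import boolp classical_sets functions cardinality filter.

Set Implicit Arguments.
Unset Strict Implicit.
Unset Printing Implicit Defensive.

Import Order.TTheory GRing.Theory Num.Theory.

Local Open Scope classical_set_scope.
Local Open Scope ring_scope.

(* The library's [Filter] (as opposed to [ProperFilter]) allows the improper
   filter; it asks for [F setT] where one may equivalently ask for [F !=set0]. *)
Lemma FilterE (F : set_system rat) :
  Filter F <->
  [/\ F !=set0,
      (forall A B, F A -> F B -> F (A `&` B)) &
      (forall A B, A `<=` B -> F A -> F B)].
Proof.
split=> [[FT FI FS]|[[A FA] FI FS]].
  by split=> //; exists setT.
by split=> //; apply: (FS A).
Qed.

Definition qball (q eps : rat) : set rat :=
  [set x | q - eps < x /\ x < q + eps].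

Definition cauchy_filter (F : set_system rat) : Prop :=
  Filter F /\ forall eps : rat, 0 < eps -> exists q : rat, F (qball q eps).

Definition minimal_cauchy_filter (F : set_system rat) : Prop :=
  cauchy_filter F /\
  forall G : set_system rat, cauchy_filter G -> G `<=` F -> G = F.

Definition filter_reals : set (set_system rat) :=
  [set F | minimal_cauchy_filter F].

(* Main.v *)
(** Given countably many Cauchy filters [F n], nested rational balls [B n] of
    radius [4 ^- n] are chosen so that [B n.+1] is disjoint from some member of
    [F n] and stays away from the boundary of [B n].  The filter generated by
    the [B n] is Cauchy; it is minimal because a ball of small radius that meets
    [B n.+1] lies inside [B n]; and it differs from every [F n], because it does
    not contain the empty set. *)
Require Import Defs.
From mathcomp Require Import all_boot all_order all_algebra.
From mathcomp Require Import boolp classical_sets functions cardinality filter.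
From mathcomp Require Import lra.

Import Order.TTheory GRing.Theory Num.Theory.

Local Open Scope classical_set_scope.
Local Open Scope ring_scope.

Lemma qball_center (q eps : rat) : 0 < eps -> qball q eps q.
Proof. by move=> e0; split; lra. Qed.

Lemma subset_qball {p q d e : rat} :
  q - e <= p - d -> p + d <= q + e -> qball p d `<=` qball q e.
Proof. by move=> h1 h2 x [x1 x2]; split; lra. Qed.

Lemma exprVn_lt_archi {R : archiRealFieldType} {b eps : R} :
  2 <= b -> 0 < eps -> exists n, b ^- n < eps.
Proof.
move=> b2 e0; exists (Num.bound eps^-1).
have b0 : 0 < b by apply: lt_le_trans b2.
rewrite invf_plt ?posrE ?exprn_gt0 //.
apply: lt_le_trans (upper_nthrootP (leqnn _)) _.
by rewrite lerXn2r ?nnegrE ?ler0n //; exact: ltW.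
Qed.

(** No finite intersections are taken: for a decreasing [B] the upward closure is already a
    filter. *)
Definition generated_by (B : nat -> set rat) : set_system rat :=
  [set A | exists n, B n `<=` A].

Lemma generated_by_mem (B : nat -> set rat) n : generated_by B (B n).
Proof. by exists n. Qed.

Section NestedBalls.
Variables c r : nat -> rat.
Hypothesis r_gt0 : forall n, 0 < r n.
Hypothesis r_small : forall eps : rat, 0 < eps -> exists n, r n < eps.
Hypothesis nested_l : forall n, c n - r n < c n.+1 - r n.+1.
Hypothesis nested_r : forall n, c n.+1 + r n.+1 < c n + r n.

Let B n := qball (c n) (r n).

Lemma nested_qball_sub {m n} : (m <= n)%N -> B n `<=` B m.
Proof.
elim: n => [|n IH]; first by rewrite leqn0 => /eqP ->.
rewrite leq_eqVlt => /predU1P[->//|/IH]; apply: subset_trans.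
by apply: subset_qball; exact: ltW.
Qed.

Lemma nested_qball_proper : ~ generated_by B set0.
Proof. by move=> [n /(_ (c n))]; apply; exact: qball_center. Qed.

Lemma nested_qball_filter : Filter (generated_by B).
Proof.
split; first by exists 0%N.
- move=> X Y [m mX] [n nY]; exists (maxn m n) => x Bx; split.
    exact/mX/(nested_qball_sub (leq_maxl m n)).
  exact/nY/(nested_qball_sub (leq_maxr m n)).
- by move=> X Y XY [n nX]; exists n; exact: subset_trans XY.
Qed.

Lemma nested_qball_cauchy : cauchy_filter (generated_by B).
Proof.
split; first exact: nested_qball_filter.
move=> eps /r_small[n rn]; exists (c n), n.
by apply: subset_qball; lra.
Qed.

Lemma nested_qball_minimal : minimal_cauchy_filter (generated_by B).
Proof.
split; first exact: nested_qball_cauchy.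
move=> H [FH CH] HG; apply/seteqP; split=> // A [n nA].
apply: filterS nA _.
(* Here [d] is half the smaller gap between the ends of [B n.+1] and [B n]. A ball of radius [d] has
   length [d + d], so it cannot reach from [B n.+1] past an end of [B n]. *)
have [d [d0 dl dr]] : exists d, [/\ 0 < d,
    d + d <= c n.+1 - r n.+1 - (c n - r n) &
    d + d <= c n + r n - (c n.+1 + r n.+1)].
  have hl := nested_l n; have hr := nested_r n.
  have [le|lt] := leP (c n.+1 - r n.+1 - (c n - r n))
                     (c n + r n - (c n.+1 + r n.+1)).
    by exists ((c n.+1 - r n.+1 - (c n - r n)) / 2); split; lra.
  by exists ((c n + r n - (c n.+1 + r n.+1)) / 2); split; lra.
have [q Hq] := CH _ d0.
have [m mq] := HG _ Hq.
(* This center lies in [B n.+1] and, through [B m], in the ball around [q], so the two meet. *)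
pose x := c (maxn m n.+1).
have Bx : B (maxn m n.+1) x by exact: qball_center.
have [qx1 qx2] := mq _ (nested_qball_sub (leq_maxl m n.+1) _ Bx).
have [nx1 nx2] := nested_qball_sub (leq_maxr m n.+1) _ Bx.
by apply: filterS Hq; apply: subset_qball; lra.
Qed.

End NestedBalls.

Fixpoint avoiding_center (q : nat -> rat) (n : nat) : rat :=
  if n is m.+1 then
    let c := avoiding_center q m in
    if q m <= c then c + 4 ^- m / 2 else c - 4 ^- m / 2
  else 0.

(** Put [r = 4 ^- n]. On the side of [c n] away from [q n], the new ball covers the distances from
    [r / 4] to [3 * r / 4], while the ball around [q n] reaches at most [r / 8] past [c n] on that
    side. *)
Lemma avoiding_centerP (q : nat -> rat) n (c := avoiding_center q) :
  [/\ c n - 4 ^- n < c n.+1 - 4 ^- n.+1,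
      c n.+1 + 4 ^- n.+1 < c n + 4 ^- n &
      qball (q n) (4 ^- n / 8) `&` qball (c n.+1) (4 ^- n.+1) = set0].
Proof.
have r0 : 0 < 4 ^- n :> rat by rewrite invr_gt0 exprn_gt0.
have -> : 4 ^- n.+1 = 4 ^- n / 4 :> rat by rewrite exprSr invfM mulrC.
rewrite /c /=; case: (leP (q n) (avoiding_center q n)) => qc;
  by split; [lra | lra | apply/seteqP; split=> // x [[? ?] [? ?]]; exfalso; lra].
Qed.

Lemma minimal_cauchy_filter_avoiding (q : nat -> rat) :
  exists2 G, minimal_cauchy_filter G &
    forall n, ~ G (qball (q n) (4 ^- n / 8)).
Proof.
pose c := avoiding_center q; pose r n : rat := 4 ^- n.
have r0 n : 0 < r n by rewrite invr_gt0 exprn_gt0.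
have nl n : c n - r n < c n.+1 - r n.+1 by have [] := avoiding_centerP q n.
have nr n : c n.+1 + r n.+1 < c n + r n by have [] := avoiding_centerP q n.
exists (generated_by (fun n => qball (c n) (r n))).
  by apply: nested_qball_minimal => // eps; exact: exprVn_lt_archi.
move=> n Gq; apply: (nested_qball_proper c r r0).
(* The empty set is rewritten as an intersection of two members of the filter. *)
have [_ _ <-] := avoiding_centerP q n.
have FG := nested_qball_filter c r nl nr.
by apply: filterI Gq _; exact: (generated_by_mem _ n.+1).
Qed.

Theorem theorem5p1 : ~ countable filter_reals.
Proof.
move=> /countable_injP[f f_inj].
(* By injectivity at most one filter has code [n], so one center serves all of them; if there is
   none, the value 0 is arbitrary. *)
have /choice[q qP] : forall n, exists q : rat, forall F,
    filter_reals F -> f F = n -> F (qball q (4 ^- n / 8)).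
  move=> n; have [[F [RF fF]]|noF] :=
    pselect (exists F, filter_reals F /\ f F = n); last first.
    by exists 0 => F RF fF; case: noF; exists F.
  have [[_ CF] _] := RF.
  have [|q Fq] := CF (4 ^- n / 8).
    by rewrite divr_gt0 ?invr_gt0 ?exprn_gt0.
  exists q => F' RF' fF'.
  by rewrite (f_inj F' F) ?inE // fF' fF.
have [G RG Gq] := minimal_cauchy_filter_avoiding q.
(* Diagonal step: [G] contains the ball with index its own code [f G], which it was built to
   avoid. *)
exact: Gq (qP _ _ RG erefl).
Qed.
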